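(* Let $G=(V,E)$ be a finite simple undirected graph, $\ell:E\to\mathbb{R}_{\ge 0}$ a length function, $s,t\in V$, and $d\in\mathbb{R}$. Let $S_d\subseteq\{0,1\}^E$ be the set of orientations $f$ of $G$ such that in $\vec G^f$ the distance (with respect to $\ell$) from $s$ to $t$ is at most $d$. Then $S_d$ is shattering-extremal.
   Context: Fix an arbitrary reference direction for each edge of $G$. An orientation of $G$ is a function $f\in\{0,1\}^E$; $\vec G^f$ is the digraph obtained by directing each edge $e$ along its reference direction if $f(e)=0$ and against it if $f(e)=1$. The distance from $s$ to $t$ is the minimum length of a directed $s$-$t$ path ($+\infty$ if none exists). For disjoint sets $A,B$ and $g\in\{0,1\}^A$, $h\in\{0,1\}^B$, $g\star h\in\{0,1\}^{A\cup B}$ is the function agreeing with $g$ on $A$ and with $h$ on $B$. For $S\subseteq\{0,1\}^E$ and $Y\subseteq E$: $S$ shatters $Y$ if for every $h\in\{0,1\}^Y$ there exists $g\in\{0,1\}^{E\setminus Y}$ with $g\star h\in S$; $S$ strongly shatters $Y$ if there exists $g\in\{0,1\}^{E\setminus Y}$ such that $g\star h\in S$ for every $h\in\{0,1\}^Y$. $S$ is shattering-extremal if the family of sets shattered by $S$ equals the family of sets strongly shattered by $S$. *)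

(* Defs.v *)
From mathcomp Require Import all_boot all_order all_algebra.
From mathcomp Require Import boolp classical_sets cardinality reals ereal.

Set Implicit Arguments.
Unset Strict Implicit.
Unset Printing Implicit Defensive.
Import Order.TTheory GRing.Theory Num.Theory.
Local Open Scope ring_scope.

Section Shattering.
Variable E : finType.
Implicit Types (S : {set {ffun E -> bool}}) (Y : {set E}).

Definition cube_in Y := {ffun {x : E | x \in Y} -> bool}.
Definition cube_out Y := {ffun {x : E | x \notin Y} -> bool}.

Definition star Y (g : cube_out Y) (h : cube_in Y) : {ffun E -> bool} :=
  [ffun x => match boolP (x \in Y) with
             | AltTrue xY => h (exist _ x xY)
             | AltFalse xNY => g (exist _ x xNY)
             end].

Definition shatters S Y : bool :=
  [forall h : cube_in Y, exists g : cube_out Y, star g h \in S].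

Definition strongly_shatters S Y : bool :=
  [exists g : cube_out Y, forall h : cube_in Y, star g h \in S].

Definition shattering_extremal S : Prop :=
  [set Y | shatters S Y]%SET = [set Y | strongly_shatters S Y]%SET.

Lemma star_in Y (g : cube_out Y) (h : cube_in Y) (x : {x : E | x \in Y}) :
  star g h (val x) = h x.
Proof.
case: x => x xY; rewrite ffunE /=.
case: {-}_ / boolP => [xY'|xN]; last by have := xN; rewrite xY.
by congr (h _); apply: val_inj.
Qed.

Lemma star_out Y (g : cube_out Y) (h : cube_in Y) (x : {x : E | x \notin Y}) :
  star g h (val x) = g x.
Proof.
case: x => x xY; rewrite ffunE /=.
case: {-}_ / boolP => [xY'|xY']; first by have := xY; rewrite xY'.
by congr (g _); apply: val_inj.
Qed.

End Shattering.

Section Graph.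
Variable V : finType.

(* A simple graph on V is given by its edge set E, all of whose members are   *)
(* 2-element subsets of V.                                                    *)
Definition simple_graph (E : {set {set V}}) : Prop :=
  forall A, A \in E -> #|A| = 2%N.

Variable E : {set {set V}}.

Definition edge := {A : {set V} | A \in E}.

(* r a = (u, v) means that the reference direction of a is from u to v.       *)
Definition reference_direction (r : edge -> V * V) : Prop :=
  forall a : edge, val a = [set (r a).1; (r a).2]%SET.

Definition orientation := {ffun edge -> bool}.

Definition arc_tail (r : edge -> V * V) (f : orientation) (a : edge) : V :=
  if f a then (r a).2 else (r a).1.
Definition arc_head (r : edge -> V * V) (f : orientation) (a : edge) : V :=
  if f a then (r a).1 else (r a).2.

Fixpoint diwalk r f (x : V) (p : seq edge) (y : V) : bool :=
  if p is a :: p' then (arc_tail r f a == x) && diwalk r f (arc_head r f a) p' y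
  else x == y.

(* Paths are walks without repeated vertices, as sequences of edges; the      *)
(* empty sequence is the path from a vertex to itself.                        *)
Definition dipath r f x p y : bool :=
  diwalk r f x p y && uniq (x :: map (arc_head r f) p).

Variable R : realType.

Definition path_length (l : edge -> R) (p : seq edge) : R := \sum_(a <- p) l a.

(* The infimum, in the extended reals, of a finite set (cf. dist_leP); it is  *)
(* +oo when there is no path.                                                 *)
Definition dist r (l : edge -> R) f (s t : V) : \bar R :=
  ereal_inf [set (path_length l p)%:E | p in [set p | dipath r f s p t]]%classic.

Definition orientations_dist_le r (l : edge -> R) (s t : V) (d : R) :
    {set {ffun edge -> bool}} :=
  [set f : orientation | (dist r l f s t <= d%:E)%E]%SET.

Lemma dipath_finite r f s t : finite_set [set p | dipath r f s p t]%classic.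
Proof.
apply: (@sub_finite_set _ _
  (\bigcup_(k in `I_#|V|.+1) [set` [seq val p | p : k.-tuple edge]])%classic).
  move=> p /andP[_ up]; exists (size p) => /=.
    rewrite ltnS; apply: leq_trans (max_card (mem (s :: map (arc_head r f) p))).
    by rewrite (card_uniqP up) /= size_map.
  by apply/mapP; exists (in_tuple p); rewrite ?mem_enum.
apply: bigcup_finite => [|k _]; first exact: finite_II.
exact: finite_seq.
Qed.

Lemma dist_leP r (l : edge -> R) f s t (d : R) :
  (dist r l f s t <= d%:E)%E <->
  exists2 p, dipath r f s p t & path_length l p <= d.
Proof.
split=> [|[p pp pd]]; last first.
  apply: (@le_trans _ _ (path_length l p)%:E); last by rewrite lee_fin.
  by apply: ereal_inf_lbound; exists p.
move=> dd; apply: contrapT => /forall2NP N.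
have /finite_seqP[q qE] := dipath_finite r f s t.
pose m := (\big[Order.min/+oo]_(p <- q) (path_length l p)%:E)%E.
have mle : (m <= dist r l f s t)%E.
  apply: le_ereal_inf_tmp => _ [p pp <-].
  have pq : [set` q]%classic p by rewrite -qE.
  exact: ge_bigmin_seq.
have : (d%:E < m)%E.
  rewrite /m big_seq; elim/big_ind: _ => [|x y dx dy|p pq]; rewrite ?ltry //.
    by rewrite lt_min dx.
  rewrite lte_fin ltNge; apply/negP => pd.
  have : [set` q]%classic p by [].
  by rewrite -qE => pp; case: (N p).
by rewrite ltNge (le_trans mle dd).
Qed.

End Graph.

(* Main.v *)
(** Suppose [Y] is shattered, and let [D v] be the distance from [s] to [v] in
    the undirected graph formed by the edges outside [Y].  Direct every edge of
    [Y] towards its endpoint of smaller [D].  Whatever the directions of the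
    other edges, along each arc [a] the value of [D] grows by at most [l a], so
    a directed path from [s] to [t] of length at most [d] forces [D t <= d].
    Hence some [s]-[t] path of length at most [d] avoids [Y]; directing its
    edges forward is a choice outside [Y] that works for all directions of the
    edges in [Y]. *)

Require Import Defs.
From mathcomp Require Import all_boot all_order all_algebra.
From mathcomp Require Import boolp reals.
Import Order.TTheory GRing.Theory Num.Theory.
Local Open Scope ring_scope.

Set Implicit Arguments.
Unset Strict Implicit.
Unset Printing Implicit Defensive.

Section DirectedPaths.
Variables (V : finType) (E : {set {set V}}) (r : edge E -> V * V).
Implicit Types (f : orientation E) (a : edge E) (p q : seq (edge E)).
Implicit Types (x y z : V).

Lemma arc_head_eq f f' a : f a = f' a -> arc_head r f a = arc_head r f' a.
Proof. by rewrite /arc_head => ->. Qed.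

Lemma arc_tail_eq f f' a : f a = f' a -> arc_tail r f a = arc_tail r f' a.
Proof. by rewrite /arc_tail => ->. Qed.

Lemma eq_in_diwalk f f' x p y :
  {in p, f =1 f'} -> diwalk r f x p y = diwalk r f' x p y.
Proof.
elim: p x => //= a p IHp x eqf.
have fa : f a = f' a by apply: eqf; rewrite mem_head.
rewrite (arc_tail_eq fa) (arc_head_eq fa) IHp // => b bp.
by apply: eqf; rewrite in_cons bp orbT.
Qed.

Lemma eq_in_dipath f f' x p y :
  {in p, f =1 f'} -> dipath r f x p y = dipath r f' x p y.
Proof.
move=> eqf; rewrite /dipath (eq_in_diwalk _ _ eqf).
suff -> : map (arc_head r f) p = map (arc_head r f') p by [].
by apply/eq_in_map => a ap; apply/arc_head_eq/eqf.
Qed.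

Lemma diwalk_cat f x p q y :
  diwalk r f x (p ++ q) y =
  diwalk r f x p (last x (map (arc_head r f) p)) &&
  diwalk r f (last x (map (arc_head r f) p)) q y.
Proof. by elim: p x => [|a p IHp] x /=; rewrite ?eqxx // IHp andbA. Qed.

Lemma diwalk_last f x p y :
  diwalk r f x p y -> last x (map (arc_head r f) p) = y.
Proof. by elim: p x => [x /eqP|a p IHp x /= /andP[_ /IHp]]. Qed.

Lemma dipath_truncate f x p y z : dipath r f x p y ->
  z \in x :: map (arc_head r f) p ->
  exists p1 p2, p = p1 ++ p2 /\ dipath r f x p1 z.
Proof.
move=> /andP[wp up]; rewrite in_cons => /predU1P[->|/mapP[a /splitPr ap ->]].
  by exists [::], p; rewrite /dipath /= eqxx.
case: ap wp up => p1 p2; rewrite -cat_rcons => wp up.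
exists (rcons p1 a), p2; split=> //; apply/andP; split.
  by move: wp; rewrite diwalk_cat map_rcons last_rcons => /andP[].
by move: up; rewrite map_cat -cat_cons cat_uniq => /andP[].
Qed.

(** Whatever [f'] is, the head of [a] under it is one of the two endpoints of [a], and a path
    through [a] visits both. The contrapositive certifies that an edge is absent from a path. *)
Lemma arc_head_in_dipath f f' x p y a : dipath r f x p y -> a \in p ->
  arc_head r f' a \in x :: map (arc_head r f) p.
Proof.
move=> /andP[+ _]; elim: p x => //= b p IHp x /andP[/eqP <- wp].
rewrite in_cons => /predU1P[->|/(IHp _ wp) hp]; last by rewrite in_cons hp orbT.
by rewrite /arc_head /arc_tail !in_cons; case: (f' b); case: (f b);
  rewrite eqxx ?orbT.
Qed.

End DirectedPaths.

Section DistanceAvoiding.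
Variables (R : realType) (V : finType) (E : {set {set V}}).
Variables (r : edge E -> V * V) (l : edge E -> R).
Hypothesis l_ge0 : forall a, 0 <= l a.
Variables (s : V) (Y : {set edge E}).

(* As the orientation is existentially quantified, this says that the
   undirected distance from [s] to [x] outside [Y] is at most [c]. *)
Definition reach_avoiding (x : V) (c : R) : Prop :=
  exists f p, [/\ dipath r f s p x, {in p, forall a, a \notin Y}
                & path_length l p <= c].

Lemma path_length_ge0 p : 0 <= path_length l p.
Proof. exact: sumr_ge0. Qed.

Lemma path_length_cat p q :
  path_length l (p ++ q) = path_length l p + path_length l q.
Proof. by rewrite /path_length big_cat. Qed.

Lemma path_length_cons a p : path_length l (a :: p) = l a + path_length l p.
Proof. by rewrite /path_length big_cons. Qed.

Lemma reach_avoiding_le x c c' :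
  c <= c' -> reach_avoiding x c -> reach_avoiding x c'.
Proof.
by move=> cc' [f [p [pp pY pc]]]; exists f, p; split=> //; apply: le_trans cc'.
Qed.

Lemma reach_avoiding_source : reach_avoiding s 0.
Proof.
exists [ffun=> false], [::]; split=> //; first by rewrite /dipath /= eqxx.
by rewrite /path_length big_nil.
Qed.

(** The bounds [c] valid for a given vertex form an upward closed set of reals, and two such sets
    are always nested. This compares [D x] with [D y] even when one of them is infinite. *)
Lemma reach_avoiding_total x y :
  (forall c, reach_avoiding x c -> reach_avoiding y c) \/
  (forall c, reach_avoiding y c -> reach_avoiding x c).
Proof.
have [|/existsNP[c0 /not_implyP[xc0 yc0]]] :=
  pselect (forall c, reach_avoiding x c -> reach_avoiding y c); first by left.
right=> c yc; have [cc0|/ltW c0c] := leP c c0.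
  by case: yc0; apply: reach_avoiding_le yc.
exact: reach_avoiding_le xc0.
Qed.

(** Triangle inequality for [D]. Since paths may not repeat vertices, [a] can be appended only if
    its head is new; otherwise the path is cut at that head, which does not lengthen it as [l] is
    nonnegative. *)
Lemma reach_avoiding_step f a c : a \notin Y ->
  reach_avoiding (arc_tail r f a) c ->
  reach_avoiding (arc_head r f a) (c + l a).
Proof.
move=> aY [f0 [p [pp pY pc]]].
have [hp|hNp] := boolP (arc_head r f a \in s :: map (arc_head r f0) p).
  have [p1 [p2 [pE pp1]]] := dipath_truncate pp hp.
  exists f0, p1; split=> // [b bp|].
    by apply: pY; rewrite pE mem_cat bp.
  rewrite -[leLHS]addr0 lerD //; apply: le_trans pc.
  by rewrite pE path_length_cat lerDl path_length_ge0.
have aNp : a \notin p.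
  by apply: contra hNp; apply: arc_head_in_dipath pp.
(* [f0] may direct [a] the other way. As [a] is not on [p], redirecting it leaves [p] a path. *)
pose f1 : orientation E := [ffun b => if b == a then f a else f0 b].
have f1a : f a = f1 a by rewrite ffunE eqxx.
have pp1 : dipath r f1 s p (arc_tail r f a).
  rewrite -(@eq_in_dipath _ _ _ f0) // => b bp; rewrite ffunE.
  by case: eqP bp => // ->; rewrite (negPf aNp).
have hE : map (arc_head r f1) p = map (arc_head r f0) p.
  apply/eq_in_map => b bp; apply: arc_head_eq; rewrite ffunE.
  by case: eqP bp => // ->; rewrite (negPf aNp).
exists f1, (rcons p a); split.
- case/andP: pp1 => wp up; apply/andP; split.
    rewrite -cats1 diwalk_cat (diwalk_last wp) wp /=.
    by rewrite -(arc_tail_eq r f1a) -(arc_head_eq r f1a) !eqxx.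
  rewrite map_rcons -rcons_cons rcons_uniq up andbT hE.
  by rewrite -(arc_head_eq r f1a).
- by move=> b; rewrite mem_rcons in_cons => /predU1P[->|/pY].
- rewrite -cats1 path_length_cat path_length_cons.
  by rewrite {2}/path_length big_nil addr0 lerD.
Qed.

(** The hypothesis says that [D] never increases along arcs in [Y]; along any other arc it grows by
    at most [l a]. *)
Lemma reach_avoiding_diwalk f x p y c :
  (forall a, a \in Y -> forall c',
     reach_avoiding (arc_tail r f a) c' ->
     reach_avoiding (arc_head r f a) c') ->
  diwalk r f x p y -> reach_avoiding x c ->
  reach_avoiding y (c + path_length l p).
Proof.
move=> fY; elim: p x c => [x c /= /eqP -> |a p IHp x c /= /andP[/eqP <- wp] xc].
  by rewrite /path_length big_nil addr0.
rewrite path_length_cons addrA; apply: IHp wp _.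
have [aY|aY] := boolP (a \in Y); last exact: reach_avoiding_step.
by apply: reach_avoiding_le (fY _ aY _ xc); rewrite lerDl.
Qed.

Lemma shatters_reach_avoiding t d :
  shatters (orientations_dist_le r l s t d) Y -> reach_avoiding t d.
Proof.
(* The value [true] reverses an edge, making [(r a).1] its head; it is chosen exactly when
   [D (r a).1 <= D (r a).2]. *)
pose h : cube_in Y := [ffun a => `[< forall c,
  reach_avoiding (r (val a)).2 c -> reach_avoiding (r (val a)).1 c >]].
move=> /forallP/(_ h)/existsP[g]; rewrite inE => /dist_leP[p /andP[wp _] pd].
apply: reach_avoiding_le pd _; rewrite -[path_length l p]add0r.
apply: reach_avoiding_diwalk wp reach_avoiding_source => a aY.
rewrite /arc_tail /arc_head (star_in g h (exist _ a aY)) ffunE /=.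
case: asboolP => // N.
by case: (reach_avoiding_total (r a).1 (r a).2).
Qed.

Lemma reach_avoiding_strongly_shatters t d :
  reach_avoiding t d -> strongly_shatters (orientations_dist_le r l s t d) Y.
Proof.
move=> [f [p [pp pY pd]]]; apply/existsP.
(* Since [p] avoids [Y], [f] restricted outside [Y] already fixes every direction along [p]. *)
exists [ffun a => f (val a)]; apply/forallP => h; rewrite inE.
apply/dist_leP; exists p => //; rewrite (@eq_in_dipath _ _ _ _ f) // => a ap.
by rewrite (star_out _ h (exist _ a (pY a ap))) ffunE.
Qed.

End DistanceAvoiding.

Lemma strongly_shatters_shatters (E : finType) (S : {set {ffun E -> bool}})
    (Y : {set E}) : strongly_shatters S Y -> shatters S Y.
Proof.
move=> /existsP[g /forallP gS]; apply/forallP => h.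
by apply/existsP; exists g.
Qed.

Unset Implicit Arguments.

Theorem theorem4p7 (R : realType) (V : finType) (E : {set {set V}})
    (simpleE : simple_graph E)
    (r : edge E -> V * V) (refr : reference_direction r)
    (l : edge E -> R) (l_ge0 : forall a : edge E, 0 <= l a)
    (s t : V) (d : R) :
  shattering_extremal (orientations_dist_le r l s t d).
Proof.
apply/setP => Y; rewrite !inE; apply/idP/idP.
  move=> /(shatters_reach_avoiding l_ge0).
  exact: reach_avoiding_strongly_shatters.
exact: strongly_shatters_shatters.
Qed.
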